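(* Let $n,p\ge1$ be integers. The element $\delta_{(n,p)}\in\widehat{F}_{(n,p)}$ has valuation $\ge n+p-1$ with respect to the total degree of $\widehat{F}_{(n,p)}$; that is, all its homogeneous components of total degree $<n+p-1$ vanish.
   Context: Work over a field of characteristic $0$. $\mathrm{Free}_{(n,p)}$ is the free Lie algebra on generators $\tilde x_{i,j}$, $(i,j)\in\{1,\dots,n\}\times\{1,\dots,p\}$; $F_{(n,p)}$ is its quotient by the relations $[\tilde x_{i,j},\tilde x_{i',j'}]=0$ whenever $i\ne i'$ and $j\ne j'$, and $x_{i,j}$ denotes the image of $\tilde x_{i,j}$. The total degree gives each $x_{i,j}$ degree $1$; $\widehat{F}_{(n,p)}=\prod_{d\ge0}(F_{(n,p)})_d$ is the completion. For elements $y_1,\dots,y_N$ of positive valuation in a completed graded Lie algebra, $y_1\star\cdots\star y_N$ denotes the image of the Campbell–Baker–Hausdorff series, i.e. the unique Lie series with $\exp(y_1\star\cdots\star y_N)=\exp(y_1)\cdots\exp(y_N)$ (the empty product being $0$). Define $$\delta_{(n,p)}=\sum_{k=0}^n\sum_{l=0}^p\sum_{\substack{1\le i_1<\cdots<i_k\le n\\1\le j_1<\cdots<j_l\le p}}(-1)^{n+p-k-l}(x_{i_1,j_1}\star\cdots\star x_{i_1,j_l})\star(x_{i_2,j_1}\star\cdots\star x_{i_2,j_l})\star\cdots\star(x_{i_k,j_1}\star\cdots\star x_{i_k,j_l}).$$ *)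

(* Defs.v *)
From HB Require Import structures.
From mathcomp Require Import all_boot all_order all_algebra.
Set Implicit Arguments. Unset Strict Implicit. Unset Printing Implicit Defensive.
Import GRing.Theory.
Local Open Scope ring_scope.

(* Completed free associative algebra K<<A>> on a finite alphabet A:
   a formal series is a function from words (seq A) to K.  The homogeneous
   component of degree d is the restriction to words of length d. *)
Section Series.
Variables (K : fieldType) (A : finType).

Definition series := seq A -> K.

Definition szero : series := fun _ => 0.
Definition sone : series := fun w => (w == [::])%:R.
Definition sgen (a : A) : series := fun w => (w == [:: a])%:R.
Definition sadd (f g : series) : series := fun w => f w + g w.
Definition sopp (f : series) : series := fun w => - f w.
Definition sscale (c : K) (f : series) : series := fun w => c * f w.
Definition smul (f g : series) : series :=
  fun w => \sum_(k < (size w).+1) f (take k w) * g (drop k w).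
Definition spow (f : series) (k : nat) : series := iter k (smul f) sone.
(* exp of a series without constant term: \sum_k f^k / k! (finite on each word) *)
Definition sexp (f : series) : series :=
  fun w => \sum_(k < (size w).+1) (k`!%:R)^-1 * spow f k w.
(* log of a series with constant term 1: \sum_{k>=1} (-1)^(k+1) (g-1)^k / k *)
Definition slog (g : series) : series :=
  fun w => \sum_(k < (size w).+1 | (0 < k)%N)
             ((-1) ^+ k.+1 / k%:R) * spow (sadd g (sopp sone)) k w.
(* Campbell-Baker-Hausdorff product y_1 * ... * y_N := log(exp y_1 ... exp y_N);
   the empty product is log 1 = 0. *)
Definition sbch (l : seq series) : series :=
  slog (foldr smul sone (map sexp l)).
Definition sbr (f g : series) : series := sadd (smul f g) (sopp (smul g f)).
Definition shom (d : nat) (f : series) : series :=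
  fun w => if size w == d then f w else 0.

(* The free Lie algebra on A, realized as the Lie polynomials inside K<A>. *)
Inductive liepoly : series -> Prop :=
| lp_gen a : liepoly (sgen a)
| lp_zero : liepoly szero
| lp_add f g : liepoly f -> liepoly g -> liepoly (sadd f g)
| lp_scale c f : liepoly f -> liepoly (sscale c f)
| lp_br f g : liepoly f -> liepoly g -> liepoly (sbr f g).

Inductive lieideal (rel : series -> Prop) : series -> Prop :=
| li_rel r : rel r -> liepoly r -> lieideal rel r
| li_zero : lieideal rel szero
| li_add f g : lieideal rel f -> lieideal rel g -> lieideal rel (sadd f g)
| li_scale c f : lieideal rel f -> lieideal rel (sscale c f)
| li_br f g : liepoly f -> lieideal rel g -> lieideal rel (sbr f g).

End Series.

Definition xgen (K : fieldType) (n p : nat) (i : 'I_n) (j : 'I_p)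
  : series K ('I_n * 'I_p)%type := sgen K (i, j).

Definition Frel (K : fieldType) (n p : nat) (r : series K ('I_n * 'I_p)%type) : Prop :=
  exists (i i' : 'I_n) (j j' : 'I_p),
    i != i' /\ j != j' /\ r = sbr (xgen K i j) (xgen K i' j').

(* Lift of delta_(n,p) to the completed free Lie algebra (inside K<<x>>). *)
Definition delta (K : fieldType) (n p : nat) : series K ('I_n * 'I_p)%type :=
  fun w =>
    \sum_(I : {set 'I_n}) \sum_(J : {set 'I_p})
      (-1) ^+ (n + p - #|I| - #|J|) *
      sbch [seq sbch [seq xgen K i j | j <- [seq j <- enum 'I_p | j \in J]]
           | i <- [seq i <- enum 'I_n | i \in I]] w.

(* J_(n,p): kernel of Free_(n,p) -> F_(n,p); an element of (completed) Free
   maps to 0 in F_(n,p) iff (each homogeneous component) lies in J. *)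
Definition Fideal (K : fieldType) (n p : nat) (f : series K ('I_n * 'I_p)%type) : Prop :=
  lieideal (@Frel K n p) f.
Definition hom_component (K : fieldType) (n p : nat) (d : nat)
  (f : series K ('I_n * 'I_p)%type) : series K ('I_n * 'I_p)%type := shom d f.

(* Main.v *)
Require Import Defs.
From HB Require Import structures.
From mathcomp Require Import all_boot all_order all_algebra.
From mathcomp Require Import boolp.
From mathcomp Require Import ring zify.
Import GRing.Theory.
Local Open Scope ring_scope.

Set Implicit Arguments.
Unset Strict Implicit.
Unset Printing Implicit Defensive.

(* Let f be the logarithm of the full product of the exp(x_ij). Setting x_ij = 0
   outside I x J turns f into the (I, J) term of delta, so by inclusion-exclusion
   delta is the part of f supported on the words in which every row index and
   every column index occurs. By Campbell-Baker-Hausdorff f is a Lie series, so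
   each of its homogeneous components is a combination of iterated brackets of
   generators. A bracket of two monomials sharing neither a row nor a column
   vanishes in F_(n,p); hence a monomial of degree l that survives involves at
   most l + 1 rows and columns in total, and n + p <= l + 1 if it involves all
   of them.

   Campbell-Baker-Hausdorff is obtained from the degree derivation N: for a Lie
   series Z both e^-Z N(e^Z) = phi(ad Z)(N Z), phi(t) = (1 - e^-t) / t, and
   e^-Z W e^Z = e^(-ad Z)(W) are Lie. Thus if G is a product of exponentials and
   Z = log G, then phi(ad Z)(N Z) = G^-1 N(G) is Lie; its component of degree d
   is d Z_d plus brackets of components of Z of degree < d, and induction on d
   shows that Z is Lie. *)

(** * The algebra of formal series *)

Section SeriesRing.
Variables (K : fieldType) (A : finType).
Local Notation series := (series K A).
Implicit Types (f g h : series) (w : seq A).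

(** Splitting off the cut before the first letter gives a recursion on words, which spares [smulA]
    any reindexing of double sums. *)
Lemma smul_cons f g a w :
  smul f g (a :: w) = f [::] * g (a :: w) + smul (fun v => f (a :: v)) g w.
Proof. by rewrite /smul big_ord_recl take0 drop0. Qed.

Lemma saddA : associative (@sadd K A).
Proof. by move=> f g h; apply: funext => w; rewrite /sadd addrA. Qed.

Lemma saddC : commutative (@sadd K A).
Proof. by move=> f g; apply: funext => w; rewrite /sadd addrC. Qed.

Lemma sadd0 : left_id (@szero K A) (@sadd K A).
Proof. by move=> f; apply: funext => w; rewrite /sadd add0r. Qed.

Lemma saddN : left_inverse (@szero K A) (@sopp K A) (@sadd K A).
Proof. by move=> f; apply: funext => w; rewrite /sadd addNr. Qed.

Lemma smulDl : left_distributive (@smul K A) (@sadd K A).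
Proof.
move=> f g h; apply: funext => w; rewrite /sadd /smul -big_split /=.
by apply: eq_bigr => k _; rewrite mulrDl.
Qed.

Lemma smulDr : right_distributive (@smul K A) (@sadd K A).
Proof.
move=> f g h; apply: funext => w; rewrite /sadd /smul -big_split /=.
by apply: eq_bigr => k _; rewrite mulrDr.
Qed.

Lemma smulZl c f g : smul (sscale c f) g = sscale c (smul f g).
Proof.
apply: funext => w; rewrite /sscale /smul big_distrr /=.
by apply: eq_bigr => k _; rewrite mulrA.
Qed.

Lemma smulZr c f g : smul f (sscale c g) = sscale c (smul f g).
Proof.
apply: funext => w; rewrite /sscale /smul big_distrr /=.
by apply: eq_bigr => k _; rewrite mulrCA.
Qed.

Lemma smulA : associative (@smul K A).
Proof.
move=> f g h; apply: funext => w; elim: w f g h => [|a w IHw] f g h.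
  by rewrite /smul !big_ord_recl !big_ord0 /= !addr0 mulrA.
rewrite !smul_cons IHw.
have -> : (fun v => smul f g (a :: v)) =
    sadd (sscale (f [::]) (fun v => g (a :: v))) (smul (fun v => f (a :: v)) g).
  by apply: funext => v; rewrite smul_cons.
rewrite smulDl smulZl /sadd /sscale.
have -> : smul f g [::] = f [::] * g [::].
  by rewrite /smul big_ord_recl big_ord0 addr0.
by rewrite mulrDr addrA mulrA.
Qed.

Lemma smul1l : left_id (@sone K A) (@smul K A).
Proof.
move=> f; apply: funext => w; rewrite /smul big_ord_recl big1 => [|k _].
  by rewrite take0 drop0 /sone eqxx mul1r addr0.
by case: w k => [|a w] k; [case: k | rewrite /sone /= mul0r].
Qed.

Lemma smul1r : right_id (@sone K A) (@smul K A).
Proof.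
move=> f; apply: funext => w; rewrite /smul big_ord_recr big1 /= => [|k _].
  by rewrite take_size drop_size /sone eqxx mulr1 add0r.
rewrite /sone -size_eq0 size_drop subn_eq0 leqNgt.
by rewrite (ltn_ord k) mulr0.
Qed.

Lemma sone_neq0 : @sone K A <> @szero K A.
Proof.
by move/(congr1 (fun f : series => f [::]))/eqP; rewrite /sone /szero oner_eq0.
Qed.

HB.instance Definition _ := gen_eqMixin series.
HB.instance Definition _ := gen_choiceMixin series.
HB.instance Definition _ :=
  GRing.isZmodule.Build series saddA saddC sadd0 saddN.
HB.instance Definition _ :=
  GRing.Zmodule_isNzRing.Build series smulA smul1l smul1r smulDl smulDr
    (introN eqP sone_neq0).

Lemma sscaleA c d f : sscale c (sscale d f) = sscale (c * d) f.
Proof. by apply: funext => w; rewrite /sscale mulrA. Qed.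

Lemma sscale1 : left_id 1 (@sscale K A).
Proof. by move=> f; apply: funext => w; rewrite /sscale mul1r. Qed.

Lemma sscaleDr : right_distributive (@sscale K A) +%R.
Proof. by move=> c f g; apply: funext => w; apply: mulrDr. Qed.

Lemma sscaleDl f : {morph (@sscale K A)^~ f : c d / c + d}.
Proof. by move=> c d; apply: funext => w; apply: mulrDl. Qed.

HB.instance Definition _ :=
  GRing.Zmodule_isLmodule.Build K series sscaleA sscale1 sscaleDr sscaleDl.
HB.instance Definition _ :=
  GRing.Lmodule_isLalgebra.Build K series (fun c f g => esym (smulZl c f g)).
HB.instance Definition _ :=
  GRing.Lalgebra_isAlgebra.Build K series (fun c f g => esym (smulZr c f g)).

Lemma one_series w : (1 : series) w = (w == [::])%:R. Proof. by []. Qed.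
Lemma add_series f g w : (f + g) w = f w + g w. Proof. by []. Qed.
Lemma opp_series f w : (- f) w = - f w. Proof. by []. Qed.
Lemma scale_series c f w : (c *: f) w = c * f w. Proof. by []. Qed.
Lemma mul_series f g w :
  (f * g) w = \sum_(k < (size w).+1) f (take k w) * g (drop k w).
Proof. by []. Qed.

Lemma sum_series (I : Type) (r : seq I) (P : pred I) (F : I -> series) w :
  (\sum_(i <- r | P i) F i) w = \sum_(i <- r | P i) F i w.
Proof. by apply: (big_morph (fun f : series => f w)). Qed.

Lemma sbrE f g : sbr f g = f * g - g * f. Proof. by []. Qed.

Lemma spowE f k : spow f k = f ^+ k.
Proof. by elim: k => [|k IHk] //; rewrite exprS -IHk. Qed.

(** * Valuation and congruence of series up to a given degree *)

Definition eqm m f g := forall w, (size w < m)%N -> f w = g w.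
Definition ord k f := eqm k f 0.

Lemma eqm_eq f g : (forall m, eqm m f g) -> f = g.
Proof. by move=> H; apply: funext => w; apply: (H (size w).+1). Qed.

Lemma eqm_trans m g f h : eqm m f g -> eqm m g h -> eqm m f h.
Proof. by move=> Hfg Hgh w Hw; rewrite Hfg ?Hgh. Qed.

Lemma eqm_sym m f g : eqm m f g -> eqm m g f.
Proof. by move=> Hfg w Hw; rewrite Hfg. Qed.

Lemma eqm_sub m f g : eqm m f g <-> ord m (f - g).
Proof.
split=> H w Hw.
  by rewrite add_series opp_series H // subrr.
by apply/eqP; rewrite -subr_eq0; apply/eqP; apply: (H w Hw).
Qed.

Lemma ordW j k f : (j <= k)%N -> ord k f -> ord j f.
Proof. by move=> Hjk Hf w Hw; apply: Hf; apply: leq_trans Hjk. Qed.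

Lemma ordD k f g : ord k f -> ord k g -> ord k (f + g).
Proof. by move=> Hf Hg w Hw; rewrite add_series Hf // Hg // add0r. Qed.

Lemma ordZ k c f : ord k f -> ord k (c *: f).
Proof. by move=> Hf w Hw; rewrite scale_series Hf // mulr0. Qed.

Lemma ordN k f : ord k f -> ord k (- f).
Proof. by rewrite -scaleN1r; apply: ordZ. Qed.

Lemma ord_sum k (I : Type) (r : seq I) (P : pred I) (F : I -> series) :
  (forall i, P i -> ord k (F i)) -> ord k (\sum_(i <- r | P i) F i).
Proof. by move=> HF; elim/big_rec: _ => // i f Hi Hf; apply: ordD; auto. Qed.

Lemma ordM j k f g : ord j f -> ord k g -> ord (j + k) (f * g).
Proof.
move=> Hf Hg w Hw; apply: big1 => i _.
have [Hi|Hi] := ltnP (size (take i w)) j; first by rewrite Hf ?mul0r.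
by rewrite Hg ?mulr0 // -(ltn_add2l j) (leq_trans _ Hw) // ltnS
  -[in leqRHS](cat_take_drop i w) size_cat leq_add2r.
Qed.

Lemma ordMl k f g : ord k g -> ord k (f * g).
Proof. by rewrite -{2}[k]add0n; apply: ordM. Qed.

Lemma ordMr k f g : ord k f -> ord k (f * g).
Proof. by move=> Hf; rewrite -[k]addn0; apply: ordM. Qed.

Lemma ordX k f : ord 1 f -> ord k (f ^+ k).
Proof. by move=> Hf; elim: k => // k IHk; rewrite exprS; apply: ordM Hf IHk. Qed.

Lemma eqmM m f f' g g' : eqm m f f' -> eqm m g g' -> eqm m (f * g) (f' * g').
Proof.
move=> /eqm_sub Hf /eqm_sub Hg; apply/eqm_sub.
rewrite -[f * g](subrK (f' * g)) -mulrBl -addrA -mulrBr.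
by apply: ordD; [apply: ordMr | apply: ordMl].
Qed.

Lemma eqmX m k f f' : eqm m f f' -> eqm m (f ^+ k) (f' ^+ k).
Proof. by move=> Hf; elim: k => // k IHk; rewrite !exprS; apply: eqmM. Qed.

Lemma eqm_lin m (I : Type) (r : seq I) (c : I -> K) (F G : I -> series) :
  (forall i, eqm m (F i) (G i)) ->
  eqm m (\sum_(i <- r) c i *: F i) (\sum_(i <- r) c i *: G i).
Proof.
move=> H w Hw; rewrite !sum_series; apply: eq_bigr => i _.
by congr (_ * _); apply: H.
Qed.

(** For a summable family, stopping at the length of [w] loses nothing: [g k] vanishes on words
    shorter than [k]. *)
Definition ssum (g : nat -> series) : series :=
  fun w => \sum_(k < (size w).+1) g k w.

Definition summable (g : nat -> series) := forall k, ord k (g k).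

Lemma ssum_trunc (g : nat -> series) m M : summable g -> (m <= M)%N ->
  eqm m (ssum g) (\sum_(k < M) g k).
Proof.
move=> Hg HmM w Hw; rewrite sum_series /ssum.
rewrite -!(big_mkord xpredT (fun k => g k w)).
rewrite [RHS](big_cat_nat _ (n := (size w).+1)) //=; last by apply: leq_trans HmM.
rewrite [X in _ + X]big_nat_cond [X in _ + X]big1 ?addr0 // => k.
by rewrite andbT => /andP[Hk _]; apply: Hg.
Qed.

Lemma ssumM a b : summable a -> summable b ->
  ssum a * ssum b = ssum (fun k => \sum_(r < k.+1) a (k - r)%N * b r).
Proof.
move=> Ha Hb; have Hab r s : ord (s + r) (a s * b r) by apply: ordM.
apply: eqm_eq => m.
apply: (@eqm_trans _ (\sum_(r < m) \sum_(s < m) a s * b r)).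
  rewrite exchange_big /=.
  under eq_bigr do rewrite -mulr_sumr.
  rewrite -mulr_suml.
  by apply: eqmM; apply: ssum_trunc.
apply: eqm_sym; apply: eqm_trans (ssum_trunc (M := m) _ _) _ => //.
  move=> k; apply: ord_sum => r _.
  by rewrite -{1}(subnK (ltn_ord r : (r <= k)%N)); apply: Hab.
apply/eqm_sub.
(* With [s = k - r], the antidiagonals [k < m] fill the triangle [r + s < m]. *)
have -> : \sum_(k < m) \sum_(r < k.+1) a (k - r)%N * b r =
  \sum_(r < m) \sum_(s < m | (r + s < m)%N) a s * b r.
  rewrite (eq_bigr (fun k : 'I_m => \sum_(r < m | (r <= k)%N) a (k - r)%N * b r)).
    rewrite (exchange_big_dep xpredT) //=; apply: eq_bigr => r _.
    rewrite -(big_mkord (fun k => r <= k)%N (fun k => a (k - r)%N * b r)).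
    rewrite -(big_mkord (fun s => r + s < m)%N (fun s => a s * b r)).
    have Hr := ltnW (ltn_ord r).
    rewrite (big_cat_nat _ (n := r)) //= big_nat_cond big1 ?add0r; last first.
      by move=> k; lia.
    rewrite -{1}[val r]add0n big_addn.
    rewrite [RHS](big_cat_nat _ (n := m - r)) //=; last by rewrite leq_subr.
    rewrite [X in _ = _ + X]big_nat_cond [X in _ = _ + X]big1 ?addr0; last first.
      by move=> k; lia.
    rewrite big_nat_cond [RHS]big_nat_cond; apply: eq_big => [k|k _]; first lia.
    by rewrite addnK.
  move=> k _; rewrite (big_ord_widen _ (fun r => a (k - r)%N * b r) (ltn_ord k)).
  by apply: eq_bigl => r; rewrite ltnS.
(* Square minus triangle leaves the terms with [r + s >= m], which have valuation at least [m]. *)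
rewrite -sumrB; apply: ord_sum => r _.
rewrite [X in _ - X](bigID (fun s : 'I_m => r + s < m)%N) /= opprD addrA subrr add0r.
apply: ordN; apply: ord_sum => s; rewrite -leqNgt addnC => Hm.
exact: ordW (Hab r s).
Qed.

End SeriesRing.

(** * Exponential, logarithm and the degree derivation *)

Section ExpLogPoly.
Variables (K : fieldType).
Hypothesis Hchar : [pchar K] =i pred0.

Lemma natK_neq0 k : k.+1%:R != 0 :> K.
Proof. by rewrite (pcharf0P K).1. Qed.

Lemma factK_neq0 k : k`!%:R != 0 :> K.
Proof. by rewrite (pcharf0P K).1 // -lt0n fact_gt0. Qed.

Definition exp_poly m : {poly K} := \poly_(k < m) (k`!%:R)^-1.
Definition log_poly m : {poly K} := \poly_(k < m) ((-1) ^+ k.+1 / k%:R).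

(* With [q = exp (log (1 + X))] truncated, the chain rule gives
   [(1 + X) q' = q], which determines the coefficients of [q]. *)
Lemma exp_log_poly m i :
  (i < m)%N -> (exp_poly m \Po log_poly m)`_i = (1 + 'X : {poly K})`_i.
Proof.
case: m => // m; set e := exp_poly _; set p := log_poly _; set q := _ \Po _.
have Hp0 : p`_0 = 0 by rewrite coef_poly /= invr0 mulr0.
(* The derivative of [p] is a truncated geometric series in [-X], so multiplying it by [1 + X]
   telescopes to 1 up to order [m]. *)
have [s Hs] : exists s, (1 + 'X) * p^`() = 1 + s * 'X^m.
  exists (drop_poly m ((1 + 'X) * p^`() - 1)).
  rewrite -[LHS](subrKC 1); congr (_ + _).
  rewrite -[LHS](poly_take_drop m) -[RHS]add0r; congr (_ + _); apply/polyP => j.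
  have Hd k : (k < m)%N -> p^`()`_k = (-1) ^+ k.
    move=> Hk; rewrite coef_deriv coef_poly ltnS Hk.
    rewrite -(mulr_natr (_ / _)).
    by rewrite divfK ?natK_neq0 // !exprS; ring.
  rewrite coef_take_poly mulrDl mul1r coefB coefD coefXM coef1 coef0.
  case: ltnP => // Hj.
  by case: j Hj => [|j] Hj; rewrite !Hd ?(ltnW Hj) //= ?exprS; ring.
have [t Ht] : exists t, p ^+ m = t * 'X^m.
  exists (drop_poly 1 p ^+ m); rewrite -exprMn; congr (_ ^+ _).
  rewrite -[LHS](poly_take_drop 1) expr1 -[RHS]add0r; congr (_ + _).
  by apply/polyP => j; rewrite coef_take_poly coef0; case: j.
have He : e^`() = e - (m`!%:R)^-1 *: 'X^m.
  apply/polyP => j; rewrite coef_deriv coefB coefZ coefXn !coef_poly ltnS.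
  case: (ltngtP j m) => Hj.
  - rewrite ltnS (ltnW Hj) mulr0 subr0 factS natrM invfM.
    rewrite -(mulr_natl (_ / _)) mulrA.
    by rewrite divff ?natK_neq0 // mul1r.
  - by rewrite ltnS leqNgt Hj mul0rn mulr0 subr0.
  - by rewrite Hj leqnn mul0rn mulr1 subrr.
have Hq : (1 + 'X) * q^`() = q + (s * (e^`() \Po p) - (m`!%:R)^-1 *: t) * 'X^m.
  rewrite deriv_comp mulrCA Hs He comp_polyB comp_polyZ comp_Xn_poly Ht.
  rewrite -!mul_polyC; ring.
have Hrec j : (j < m)%N -> j.+1%:R * q`_j.+1 + j%:R * q`_j = q`_j.
  move=> Hj; have /(congr1 (fun r : {poly K} => r`_j)) := Hq.
  rewrite mulrDl mul1r !coefD coefXM coefMXn Hj addr0 => Hc.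
  by rewrite -[RHS]Hc; case: j Hj {Hc} => [|j] Hj /=; rewrite !coef_deriv !mulr_natl.
have Hq0 : q`_0 = 1.
  by rewrite -horner_coef0 horner_comp horner_coef0 Hp0 horner_coef0 coef_poly /= invr1.
rewrite coefD coef1 coefX; elim: i => [|[|i] IHi] Hi.
- by rewrite Hq0 addr0.
- by have := Hrec 0%N Hi; rewrite mul1r mul0r addr0 Hq0 add0r.
(* The recurrence gives (i+2) q_(i+2) = -i q_(i+1); either i = 0 or q_(i+1) = 0 by induction. *)
have : i.+2%:R * q`_i.+2 = 0.
  have := Hrec i.+1 Hi; rewrite (IHi (ltnW Hi)); case: i {Hi IHi} => [|i] /=.
    by move/eqP; rewrite !add0r mulr1 -subr_eq0 addrK => /eqP.
  by rewrite !addr0 mulr0 addr0.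
by move/eqP; rewrite mulf_eq0 (negPf (natK_neq0 _)) /= => /eqP ->; rewrite addr0.
Qed.

End ExpLogPoly.

Section ExpLog.
Variables (K : fieldType) (A : finType).
Local Notation series := (series K A).
Implicit Types (f g Z W : series).

Lemma sexp_sum Z : sexp Z = ssum (fun k => (k`!%:R)^-1 *: Z ^+ k).
Proof.
by apply: funext => w; apply: eq_bigr => k _; rewrite spowE.
Qed.

(* The [k = 0] term vanishes because [0^-1 = 0]. *)
Lemma slog_sum f :
  slog f = ssum (fun k => ((-1) ^+ k.+1 / k%:R) *: (f - 1) ^+ k).
Proof.
apply: funext => w; rewrite /slog big_mkcond; apply: eq_bigr => -[[|k] Hk] _ /=.
  by rewrite invr0 mulr0 scale0r.
by rewrite scale_series -spowE.
Qed.

Lemma summable_pow (c : nat -> K) Z :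
  ord 1 Z -> summable (fun k => c k *: Z ^+ k).
Proof. by move=> HZ k; apply: ordZ; apply: ordX. Qed.

Lemma ssum0 (g : nat -> series) : ssum g [::] = g 0%N [::].
Proof. by rewrite /ssum big_ord_recl big_ord0 addr0. Qed.

Lemma ord1P f : ord 1 f <-> f [::] = 0.
Proof. by split=> [|H [|a w]] //; apply. Qed.

Lemma sexp_nil Z : sexp Z [::] = 1.
Proof. by rewrite sexp_sum ssum0 scale_series invr1 mul1r. Qed.

Lemma ord_slog f : ord 1 (slog f).
Proof. by apply/ord1P; rewrite slog_sum ssum0 /= invr0 mulr0 scale0r. Qed.

Lemma horner_alg_ord (q : {poly K}) m f :
  ord 1 f -> (forall i, (i < m)%N -> q`_i = 0) -> ord m (horner_alg f q).
Proof.
move=> Hf Hq; rewrite -(poly_take_drop m q).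
have -> : take_poly m q = 0.
  by apply/polyP => i; rewrite coef_take_poly coef0; case: ltnP => // /Hq.
by rewrite add0r rmorphM rmorphXn /= horner_algX; apply: ordMl; apply: ordX.
Qed.

Lemma horner_alg_poly m (c : nat -> K) f :
  horner_alg f (\poly_(k < m) c k) = \sum_(k < m) c k *: f ^+ k.
Proof.
rewrite poly_def linear_sum /=; apply: eq_bigr => k _.
by rewrite linearZ rmorphXn /= horner_algX mulr_algl.
Qed.

Lemma horner_alg_comp m (c : nat -> K) q f :
  horner_alg f ((\poly_(k < m) c k) \Po q) =
  \sum_(k < m) c k *: horner_alg f q ^+ k.
Proof.
rewrite poly_def !linear_sum /=; apply: eq_bigr => k _.
by rewrite comp_polyZ linearZ comp_Xn_poly rmorphXn /= mulr_algl.
Qed.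

(** Up to any degree [m] both sides are polynomials in [f - 1], which has positive valuation, so
    [exp_log_poly] suffices. *)
Lemma sexp_slog f : [pchar K] =i pred0 -> f [::] = 1 -> sexp (slog f) = f.
Proof.
move=> Hchar Hf; have Hu : ord 1 (f - 1).
  by apply/ord1P; rewrite add_series Hf opp_series subrr.
apply: eqm_eq => m; rewrite sexp_sum.
apply: eqm_trans (ssum_trunc (summable_pow _ (@ord_slog f)) (leqnn m)) _.
have Hlog : eqm m (slog f) (horner_alg (f - 1) (log_poly K m)).
  by rewrite slog_sum horner_alg_poly; apply: ssum_trunc => //; apply: summable_pow.
apply: (@eqm_trans _ _ _ (horner_alg (f - 1) (exp_poly K m \Po log_poly K m))).
  by rewrite horner_alg_comp; apply: eqm_lin => k; apply: eqmX.
have {2}-> : f = horner_alg (f - 1) (1 + 'X).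
  by rewrite rmorphD rmorph1 /= horner_algX addrC subrK.
apply/eqm_sub; rewrite -rmorphB; apply: horner_alg_ord => // i Hi.
by rewrite coefB exp_log_poly // subrr.
Qed.

End ExpLog.

(** * The degree derivation and conjugation by exponentials *)

Section Degree.
Variables (K : fieldType) (A : finType).
Hypothesis Hchar : [pchar K] =i pred0.
Local Notation series := (series K A).
Implicit Types (f g Z W V : series).

Definition sdeg f : series := fun w => (size w)%:R * f w.

Lemma sdegZ c f : sdeg (c *: f) = c *: sdeg f.
Proof. by apply: funext => w; apply: mulrCA. Qed.

Lemma sdeg1 : sdeg 1 = 0.
Proof. by apply: funext => -[|a w]; rewrite /sdeg ?mul0r ?one_series ?mulr0. Qed.

Lemma sdegM f g : sdeg (f * g) = sdeg f * g + f * sdeg g.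
Proof.
apply: funext => w; rewrite /sdeg add_series !mul_series mulr_sumr -big_split /=.
apply: eq_bigr => k _; rewrite -{1}(cat_take_drop k w) size_cat natrD; ring.
Qed.

Lemma ord_sdeg k f : ord k f -> ord k (sdeg f).
Proof. by move=> Hf w Hw; rewrite /sdeg Hf // mulr0. Qed.

Lemma sdeg_ssum (g : nat -> series) : sdeg (ssum g) = ssum (sdeg \o g).
Proof. by apply: funext => w; rewrite /sdeg /ssum mulr_sumr. Qed.

Lemma ssum_mull f (g : nat -> series) :
  summable g -> f * ssum g = ssum (fun k => f * g k).
Proof.
move=> Hg; apply: eqm_eq => m.
apply: eqm_trans (eqmM (fun _ _ => erefl) (ssum_trunc Hg (leqnn m))) _.
rewrite mulr_sumr; apply: eqm_sym; apply: ssum_trunc => // k.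
exact: ordMl.
Qed.

Lemma ssum_shift (g : nat -> series) :
  summable g -> g 0%N = 0 -> ssum g = ssum (fun k => g k.+1).
Proof.
move=> Hg Hg0; apply: eqm_eq => m.
apply: eqm_trans (ssum_trunc Hg (leqnSn m)) _.
rewrite big_ord_recl Hg0 add0r; apply: eqm_sym; apply: ssum_trunc => // k.
exact: ordW (Hg k.+1).
Qed.

(** Truncated subtraction breaks [Z * Z ^+ (k - r.+1) = Z ^+ (k - r)] once [k <= r]; the
    coefficient, a binomial in each use, vanishes there. *)
Lemma scale_pow_pred (c : nat -> nat) k r Z : (k <= r -> c r = 0)%N ->
  (c r)%:R *: (Z * Z ^+ (k - r.+1)) = (c r)%:R *: Z ^+ (k - r) :> series.
Proof.
case: (leqP k r) => Hkr Hc; first by rewrite Hc // !scale0r.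
by rewrite -exprS; congr (_ *: _ ^+ _); lia.
Qed.

(** Right multiplication by [Z] is left multiplication minus ad Z, and these commute: this is the
    binomial theorem. The free bound [n] lets sums for different [k] share one range. *)
Lemma mulX_ad k n Z W : (k < n)%N ->
  W * Z ^+ k = \sum_(r < n) (-1) ^+ r *:
    ('C(k, r)%:R *: Z ^+ (k - r) * iter r (sbr Z) W).
Proof.
elim: k n W => [|k IHk] [|n] // W Hn.
  rewrite big_ord_recl big1 => [|r _]; last by rewrite bin0n scale0r mul0r scaler0.
  by rewrite bin0 !scale1r /= mul1r mulr1 addr0.
have -> : W * Z ^+ k.+1 = Z * (W * Z ^+ k) - sbr Z W * Z ^+ k.
  by rewrite sbrE exprS mulrBl !mulrA opprB addrC subrK.
rewrite (IHk n.+1) ?(IHk n) ?(ltnW Hn) //.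
rewrite !big_ord_recl mulrDr -addrA; congr (_ + _).
  by rewrite !bin0 !scale1r !subn0 /= mulrA exprS.
rewrite mulr_sumr -sumrB; apply: eq_bigr => r _.
rewrite !lift0 subSS -iterSr.
rewrite binS natrD scalerDl mulrDl scalerDr -!scalerAr mulrA -!scalerAr.
rewrite (@scale_pow_pred (fun r => 'C(k, r.+1))); last first.
  by move=> Hr; rewrite bin_small.
by congr (_ + _); rewrite [_ ^+ r.+1]exprS mulN1r scaleNr.
Qed.

(** By Leibniz the left side is the sum of the Z^i N(Z) Z^(k-i). Moving the right-hand powers to the
    left with [mulX_ad] adds up binomials, here one Pascal step per induction step. *)
Lemma sdeg_pow k n Z : (k < n)%N ->
  sdeg (Z ^+ k.+1) = \sum_(r < n) (-1) ^+ r *: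
    ('C(k.+1, r.+1)%:R *: Z ^+ (k - r) * iter r (sbr Z) (sdeg Z)).
Proof.
elim: k n => [|k IHk] n Hn.
  case: n Hn => // n _; rewrite big_ord_recl big1 => [|r _].
    by rewrite expr1 !scale1r mul1r addr0.
  by rewrite bin_small // scale0r mul0r scaler0.
rewrite exprS sdegM (mulX_ad _ _ Hn) (IHk n) ?(ltnW Hn) //.
rewrite mulr_sumr -big_split; apply: eq_bigr => r _ /=.
rewrite [in RHS]binS natrD scalerDl mulrDl scalerDr addrC; congr (_ + _).
rewrite -!scalerAr mulrA -!scalerAr -subSS.
by rewrite (@scale_pow_pred (fun r => 'C(k.+1, r.+1))) // => Hr; rewrite bin_small.
Qed.

Lemma ord_ad k Z W : ord 1 Z -> ord k (iter k (sbr Z) W).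
Proof.
move=> HZ; elim: k => //= k IHk; rewrite sbrE; apply: ordD.
  exact: (ordM HZ).
by apply: ordN; rewrite -addn1; apply: ordM.
Qed.

Lemma binK k r : (r <= k)%N ->
  k`!%:R^-1 * 'C(k, r)%:R = (k - r)`!%:R^-1 * r`!%:R^-1 :> K.
Proof.
move=> Hr; rewrite -(bin_fact Hr) !natrM.
have := factK_neq0 Hchar r; have := factK_neq0 Hchar (k - r).
have : 'C(k, r)%:R != 0 :> K by rewrite (pcharf0P K).1 // -lt0n bin_gt0.
move=> ? ? ?; field; do ?[apply/andP; split]; done.
Qed.

(** This is e^-Z W e^Z = e^(-ad Z)(W) without an inverse: divided by k!, [mulX_ad] becomes a Cauchy
    product. *)
Lemma mul_sexp_ad Z W : ord 1 Z ->
  W * sexp Z =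
  sexp Z * ssum (fun r => ((-1) ^+ r / r`!%:R) *: iter r (sbr Z) W).
Proof.
move=> HZ; rewrite sexp_sum ssum_mull; last exact: summable_pow.
rewrite ssumM; [|exact: summable_pow|by move=> k; apply: ordZ; apply: ord_ad].
congr (ssum _); apply: funext => k.
rewrite -scalerAr (mulX_ad _ _ (ltnSn k)) scaler_sumr; apply: eq_bigr => r _.
rewrite -!scalerAl -!scalerAr !scalerA; congr (_ *: _).
by rewrite mulrAC (binK (ltn_ord r : r <= k)%N) mulrAC -mulrA.
Qed.

Lemma sdeg_sexp Z : ord 1 Z ->
  sdeg (sexp Z) =
  sexp Z * ssum (fun r => ((-1) ^+ r / r.+1`!%:R) *: iter r (sbr Z) (sdeg Z)).
Proof.
move=> HZ; rewrite sexp_sum ssumM; last first.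
- by move=> k; apply: ordZ; apply: ord_ad.
- exact: summable_pow.
(* The derivation kills the constant term; the resulting shift of index produces the (r+1)! of
   phi. *)
rewrite sdeg_ssum ssum_shift => [|k|] /=; last 2 first.
- by apply: ord_sdeg; apply: ordZ; apply: ordX.
- by rewrite sdegZ sdeg1 scaler0.
congr (ssum _); apply: funext => k.
rewrite sdegZ (sdeg_pow _ (ltnSn k)) scaler_sumr; apply: eq_bigr => r _.
rewrite -!scalerAl -!scalerAr !scalerA; congr (_ *: _).
by rewrite mulrAC (binK (ltn_ord r : r < k.+1)%N) subSS mulrAC -mulrA.
Qed.

End Degree.

(** * Campbell-Baker-Hausdorff *)

Section LieSeries.
Variables (K : fieldType) (A : finType).
Hypothesis Hchar : [pchar K] =i pred0.
Local Notation series := (series K A).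
Implicit Types (f g G Z W V : series).

Lemma liepoly_sum (I : Type) (r : seq I) (P : pred I) (F : I -> series) :
  (forall i, P i -> liepoly (F i)) -> liepoly (\sum_(i <- r | P i) F i).
Proof.
move=> HF; elim/big_rec: _ => [|i f Hi Hf]; first exact: lp_zero.
by apply: lp_add => //; apply: HF.
Qed.

Lemma liepolyZ c f : liepoly f -> liepoly (c *: f).
Proof. exact: lp_scale. Qed.

Lemma liepolyB f g : liepoly f -> liepoly g -> liepoly (f - g).
Proof.
by move=> Hf Hg; rewrite -scaleN1r; apply: lp_add => //; apply: liepolyZ.
Qed.

Lemma shomD d f g : shom d (f + g) = shom d f + shom d g.
Proof.
apply: funext => w; rewrite [RHS]add_series /shom.
by case: ifP; rewrite // addr0.
Qed.

Lemma shomZ d c f : shom d (c *: f) = c *: shom d f.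
Proof.
by apply: funext => w; rewrite /shom !scale_series; case: ifP; rewrite ?mulr0.
Qed.

Lemma shomB d f g : shom d (f - g) = shom d f - shom d g.
Proof. by rewrite -scaleN1r shomD shomZ scaleN1r. Qed.

Lemma shom_ord k d f : ord k f -> (d < k)%N -> shom d f = 0.
Proof.
by move=> Hf Hd; apply: funext => w; rewrite /shom; case: eqP => // Hw;
  rewrite Hf ?Hw.
Qed.

Lemma shomM d f g : shom d (f * g) = \sum_(e < d.+1) shom e f * shom (d - e) g.
Proof.
apply: funext => w; rewrite sum_series /shom.
have [<-|Hd] := eqVneq (size w) d.
  rewrite mul_series; apply: eq_bigr => e _.
  have He : (e <= size w)%N by rewrite -ltnS.
  rewrite mul_series (bigD1 e) //= big1 ?addr0 => [|k Hk].
    by rewrite size_takel // size_drop !eqxx.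
  have Hkw : (k <= size w)%N by rewrite -ltnS.
  rewrite size_takel //; case: eqP => [Hke|]; last by rewrite mul0r.
  by case/eqP: Hk; apply: val_inj.
rewrite big1 // => e _; rewrite mul_series big1 // => k _.
have Hkw : (k <= size w)%N by rewrite -ltnS.
rewrite size_takel // size_drop; case: eqP => [Hke|]; last by rewrite mul0r.
case: eqP => [Hd'|]; last by rewrite mulr0.
by case/eqP: Hd; move: (ltn_ord e) Hke Hd' Hkw; lia.
Qed.

Lemma shom_sbr d f g :
  shom d (sbr f g) = \sum_(e < d.+1) sbr (shom e f) (shom (d - e) g).
Proof.
(* Reversing the second sum pairs the components of equal degrees into brackets. *)
rewrite sbrE shomB !shomM [X in _ - X](reindex_inj rev_ord_inj) /= -sumrB.
apply: eq_bigr => e _; have He : (e <= d)%N by rewrite -ltnS.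
by rewrite sbrE subSS (subKn He).
Qed.

Lemma shom_sdeg d f : shom d (sdeg f) = d%:R *: shom d f.
Proof.
apply: funext => w; rewrite scale_series /shom /sdeg.
by case: eqP => [->|]; rewrite ?mulr0.
Qed.

Lemma shom_ssum d (g : nat -> series) :
  shom d (ssum g) = \sum_(k < d.+1) shom d (g k).
Proof.
apply: funext => w; rewrite sum_series /shom /ssum.
by case: eqP => [->|] //; rewrite big1.
Qed.

Definition lie_upto d f := ord 1 f /\ forall e, (e < d)%N -> liepoly (shom e f).
Definition lie_series f := forall d, lie_upto d f.

Lemma lie_seriesP f :
  lie_series f <-> ord 1 f /\ forall d, liepoly (shom d f).
Proof.
split=> [H|[H1 H2] d]; last by split=> // e _.
by split=> [|d]; [case: (H 0%N) | apply: (H d.+1).2].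
Qed.

Lemma lie_uptoW d f : lie_upto d.+1 f -> lie_upto d f.
Proof. by case=> H1 H2; split=> // e He; apply: H2; apply: ltnW. Qed.

(** Positive valuation leaves only brackets of components of positive degrees with sum at most [d],
    so both degrees are below [d]. This gain of one degree drives the induction in
    [lie_series_slog]. *)
Lemma lie_upto_sbr d f g :
  lie_upto d f -> lie_upto d g -> lie_upto d.+1 (sbr f g).
Proof.
move=> [Hf1 Hf] [Hg1 Hg]; split.
  by rewrite sbrE; apply: ordD; [apply: ordMr | apply: ordN; apply: ordMr].
move=> e He; rewrite shom_sbr; apply: liepoly_sum => i _.
have Hi := ltn_ord i.
have [Hi0|Hi0] := posnP i.
  by rewrite Hi0 (shom_ord Hf1) // sbrE mul0r mulr0 subrr; apply: lp_zero.
have [Hie|Hie] := posnP (e - i).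
  by rewrite Hie (shom_ord Hg1) // sbrE mul0r mulr0 subrr; apply: lp_zero.
by apply: lp_br; [apply: Hf | apply: Hg]; lia.
Qed.

Lemma lie_upto_sdeg d f : lie_upto d f -> lie_upto d (sdeg f).
Proof.
move=> [H1 H2]; split=> [|e He]; first exact: ord_sdeg.
by rewrite shom_sdeg; apply: liepolyZ; apply: H2.
Qed.

Lemma lie_upto_ad d r f g :
  lie_upto d f -> lie_upto d g -> lie_upto d.+1 (iter r.+1 (sbr f) g).
Proof.
move=> Hf Hg; elim: r => [|r IHr]; first exact: lie_upto_sbr.
by rewrite iterS; apply: lie_upto_sbr => //; apply: lie_uptoW.
Qed.

Lemma lie_series_ad r f g :
  lie_series f -> lie_series g -> lie_series (iter r (sbr f) g).
Proof.
move=> Hf Hg d; case: r => [|r]; first exact: Hg.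
by apply: lie_uptoW; apply: lie_upto_ad.
Qed.

Lemma lie_seriesD f g : lie_series f -> lie_series g -> lie_series (f + g).
Proof.
move=> Hf Hg d; split=> [|e He]; first by apply: ordD; [case: (Hf d)|case: (Hg d)].
by rewrite shomD; apply: lp_add; [apply: (Hf d).2 | apply: (Hg d).2].
Qed.

Lemma lie_series_ssum (c : nat -> K) (g : nat -> series) :
  (forall k, lie_series (g k)) -> lie_series (ssum (fun k => c k *: g k)).
Proof.
move=> Hg; apply/lie_seriesP; split=> [|d].
  by apply/ord1P; rewrite ssum0 scale_series (ord1P _).1 ?mulr0 //; case: (Hg 0%N 0%N).
rewrite shom_ssum; apply: liepoly_sum => k _; rewrite shomZ.
by apply: liepolyZ; apply: (Hg _ d.+1).2.
Qed.

Lemma lie_series_sdeg f : lie_series f -> lie_series (sdeg f).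
Proof. by move=> Hf d; apply: lie_upto_sdeg. Qed.

Lemma lie_series0 : lie_series 0.
Proof.
apply/lie_seriesP; split=> // d.
by rewrite (@shom_ord d.+1) //; apply: lp_zero.
Qed.

Lemma lie_series_sgen a : lie_series (sgen K a).
Proof.
apply/lie_seriesP; split=> [|d]; first exact/ord1P.
have [->|Hd] := eqVneq d 1%N.
  suff -> : shom 1 (sgen K a) = sgen K a by apply: lp_gen.
  apply: funext => w; rewrite /shom /sgen; case: eqP => // Hw.
  by case: eqP => // H; rewrite H in Hw.
suff -> : shom d (sgen K a) = 0 by apply: lp_zero.
apply: funext => w; rewrite /shom /sgen; case: eqP => // Hw.
by case: eqP => // H; rewrite -Hw H in Hd.
Qed.

(** The difference h satisfies h = -(G - 1) h, and [G - 1] has positive valuation, so the valuation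
    of h exceeds every bound. *)
Lemma smulI G f g : G [::] = 1 -> G * f = G * g -> f = g.
Proof.
move=> HG /eqP; rewrite -subr_eq0 -mulrBr => /eqP HGfg.
apply: eqm_eq => m; apply/eqm_sub; elim: m => // m IHm.
have -> : f - g = - ((G - 1) * (f - g)).
  by rewrite mulrBl HGfg mul1r sub0r opprK.
apply: ordN; rewrite -add1n; apply: ordM IHm; apply/ord1P.
by rewrite add_series HG opp_series subrr.
Qed.

(* The properties of exponentials of Lie series that make the logarithm of a
   product Lie: the logarithmic degree derivation and the conjugation
   [W |-> G^-1 W G] take Lie values. *)
Definition glike G :=
  [/\ G [::] = 1,
      exists2 W, lie_series W & sdeg G = G * W &
      forall W, lie_series W -> exists2 V, lie_series V & W * G = G * V].

Lemma glike1 : glike 1.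
Proof.
split; first by [].
  by exists 0; [apply: lie_series0 | rewrite sdeg1 mulr0].
by move=> W HW; exists W => //; rewrite mulr1 mul1r.
Qed.

Lemma glikeM G H : glike G -> glike H -> glike (G * H).
Proof.
move=> [G1 [U HU EU] GC] [H1 [V HV EV] HC]; split.
- by rewrite mul_series big_ord_recl big_ord0 /= G1 H1 mulr1 addr0.
- have [U' HU' EU'] := HC U HU; exists (U' + V); first exact: lie_seriesD.
  by rewrite sdegM EU EV mulrDr -!mulrA EU'.
move=> W HW; have [W' HW' EW'] := GC W HW; have [W'' HW'' EW''] := HC W' HW'.
by exists W'' => //; rewrite mulrA EW' -mulrA EW'' mulrA.
Qed.

Lemma glike_sexp Z : lie_series Z -> glike (sexp Z).
Proof.
move=> HZ; have [HZ1 _] := HZ 0%N; split; first exact: sexp_nil.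
  rewrite sdeg_sexp //; eexists; last by [].
  by apply: lie_series_ssum => r; apply/lie_series_ad/lie_series_sdeg.
move=> W HW; rewrite mul_sexp_ad //; eexists; last by [].
by apply: lie_series_ssum => r; apply: lie_series_ad.
Qed.

Lemma lie_series_slog G : glike G -> lie_series (slog G).
Proof.
move=> [G1 [W HW EW] _]; have := sexp_slog Hchar G1; set Z := slog G => EZ.
have HZ1 : ord 1 Z by apply: ord_slog.
have EW' : W = ssum (fun r => ((-1) ^+ r / r.+1`!%:R) *: iter r (sbr Z) (sdeg Z)).
  by apply: (smulI G1); rewrite -EW -EZ sdeg_sexp.
elim=> [|d IHd]; first by split.
split=> // e; rewrite ltnS leq_eqVlt => /orP[/eqP->|]; last exact: IHd.2.
(* Degree 0 vanishes by valuation; from here on the degree is a positive integer, invertible in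
   characteristic 0. *)
case: d IHd => [|d] IHd {e}; first by rewrite (shom_ord HZ1) //; apply: lp_zero.
suff H : liepoly (d.+1%:R *: shom d.+1 Z).
  by rewrite -[shom _ _](scalerK (natK_neq0 Hchar d)); apply: liepolyZ.
(* The term [r = 0] of phi(ad Z)(N Z) is N Z, which isolates the wanted component; every other term
   is a bracket controlled by lower degrees. *)
have -> : d.+1%:R *: shom d.+1 Z = shom d.+1 W - \sum_(r < d.+1)
    shom d.+1 (((-1) ^+ r.+1 / r.+2`!%:R) *: iter r.+1 (sbr Z) (sdeg Z)).
  by rewrite EW' shom_ssum big_ord_recl /= divr1 scale1r shom_sdeg addrK.
apply: liepolyB; first exact: (HW d.+2).2.
apply: liepoly_sum => r _; rewrite shomZ; apply: liepolyZ.
by apply: (lie_upto_ad r IHd (lie_upto_sdeg IHd)).2.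
Qed.

Lemma lie_series_sbch (I : Type) (s : seq I) (F : I -> series) :
  (forall i, lie_series (F i)) -> lie_series (sbch [seq F i | i <- s]).
Proof.
move=> HF; apply: lie_series_slog; elim: s => [|i s IHs]; first exact: glike1.
by apply: glikeM IHs; apply: glike_sexp.
Qed.

End LieSeries.

(** * Inclusion-exclusion and Lie monomials *)

Section Restriction.
Variables (K : fieldType) (A : finType).
Local Notation series := (series K A).
Implicit Types (f g : series) (Q : pred (seq A)) (P : pred A).

(** For [Q = all P] this is the algebra morphism setting the generators outside [P] to 0. General
    [Q] also covers words of given length that use every row and column. *)
Definition sfilter Q f : series := fun w => if Q w then f w else 0.

Lemma sfilterD Q f g : sfilter Q (f + g) = sfilter Q f + sfilter Q g.
Proof.
apply: funext => w; rewrite [RHS]add_series /sfilter.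
by case: ifP; rewrite // addr0.
Qed.

Lemma sfilterZ Q c f : sfilter Q (c *: f) = c *: sfilter Q f.
Proof.
apply: funext => w; rewrite [RHS]scale_series /sfilter.
by case: ifP; rewrite // mulr0.
Qed.

Lemma sfilter0 Q : sfilter Q 0 = 0 :> series.
Proof. by apply: funext => w; rewrite /sfilter; case: ifP. Qed.

Lemma sfilter_ssum Q (g : nat -> series) :
  sfilter Q (ssum g) = ssum (sfilter Q \o g).
Proof.
apply: funext => w; rewrite /sfilter /ssum /=.
by case: ifP => // _; rewrite big1.
Qed.

Lemma sfilter1 P : sfilter (all P) 1 = 1 :> series.
Proof. by apply: funext => -[|a w] //; rewrite /sfilter; case: ifP. Qed.

Lemma sfilterM P f g :
  sfilter (all P) (f * g) = sfilter (all P) f * sfilter (all P) g.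
Proof.
apply: funext => w; rewrite [RHS]mul_series /sfilter mul_series.
have Hw k : all P w = all P (take k w) && all P (drop k w).
  by rewrite -all_cat cat_take_drop.
case: ifP => HPw; last rewrite big1 //.
  by apply: eq_bigr => k _; move: HPw; rewrite (Hw k) => /andP[-> ->].
by move=> k _; move: HPw; rewrite (Hw k); case: all; rewrite ?mul0r //= => ->;
  rewrite mulr0.
Qed.

Lemma sfilterX P f k : sfilter (all P) (f ^+ k) = sfilter (all P) f ^+ k.
Proof.
by elim: k => [|k IHk]; rewrite ?sfilter1 // !exprS sfilterM IHk.
Qed.

Lemma sfilter_sexp P f : sfilter (all P) (sexp f) = sexp (sfilter (all P) f).
Proof.
rewrite !sexp_sum sfilter_ssum; congr ssum; apply: funext => k /=.
by rewrite sfilterZ sfilterX.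
Qed.

Lemma sfilter_slog P f : sfilter (all P) (slog f) = slog (sfilter (all P) f).
Proof.
rewrite !slog_sum sfilter_ssum; congr ssum; apply: funext => k /=.
by rewrite sfilterZ sfilterX sfilterD -scaleN1r sfilterZ sfilter1.
Qed.

Lemma sfilter_sbch P (I : Type) (s : seq I) (F : I -> series) :
  sfilter (all P) (sbch [seq F i | i <- s]) =
  sbch [seq sfilter (all P) (F i) | i <- s].
Proof.
rewrite /sbch sfilter_slog; congr slog.
elim: s => [|i s IHs] /=; first exact: sfilter1.
by rewrite -sfilter_sexp -IHs; apply: sfilterM.
Qed.

Lemma sexp0 : sexp 0 = 1 :> series.
Proof.
apply: funext => w; rewrite sexp_sum /ssum big_ord_recl big1 => [|k _].
  by rewrite invr1 scale1r addr0.
by rewrite lift0 exprS mul0r scaler0.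
Qed.

Lemma sbch_filter (I : Type) (b : pred I) (s : seq I) (F : I -> series) :
  sbch [seq if b i then F i else 0 | i <- s] = sbch [seq F i | i <- s & b i].
Proof.
rewrite /sbch; congr slog; elim: s => [|i s IHs] //=.
by case: ifP => _ /=; rewrite IHs // sexp0; apply: mul1r.
Qed.

Lemma sbch_nil : sbch [::] = 0 :> series.
Proof.
rewrite -[sbch _]/(slog 1) slog_sum subrr.
apply: funext => w; rewrite /ssum big1 // => -[[|k] Hk] _ /=.
  by rewrite invr0 mulr0 scale0r.
by rewrite [0 ^+ _]exprS mul0r scaler0.
Qed.

End Restriction.

(** * Lie monomials, their row and column supports, and the defining ideal *)

Section Monomials.
Variables (K : fieldType) (n p : nat).
Local Notation A := ('I_n * 'I_p)%type.
Local Notation series := (series K A).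
Implicit Types (f g m : series) (w : seq A) (R : {set 'I_n}) (C : {set 'I_p}).

Definition wrows w := [set i : 'I_n | i \in [seq x.1 | x <- w]].
Definition wcols w := [set j : 'I_p | j \in [seq x.2 | x <- w]].

Lemma wrows_cat u v : wrows (u ++ v) = wrows u :|: wrows v.
Proof. by apply/setP => i; rewrite !inE map_cat mem_cat. Qed.

Lemma wcols_cat u v : wcols (u ++ v) = wcols u :|: wcols v.
Proof. by apply/setP => i; rewrite !inE map_cat mem_cat. Qed.

(* [liemon R C l m]: [m] is an iterated bracket of [l] generators whose first
   and second indices are exactly those in [R] and [C]. *)
Inductive liemon : {set 'I_n} -> {set 'I_p} -> nat -> series -> Prop :=
| liemon_gen i j : liemon [set i] [set j] 1 (xgen K i j)
| liemon_br R C l m R' C' l' m' : liemon R C l m -> liemon R' C' l' m' ->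
    liemon (R :|: R') (C :|: C') (l + l') (sbr m m').

Lemma liemon_liepoly R C l m : liemon R C l m -> liepoly m.
Proof. by elim=> *; [apply: lp_gen | apply: lp_br]. Qed.

Lemma smul_neq0 f g w : (f * g) w != 0 ->
  exists u v, [/\ w = u ++ v, f u != 0 & g v != 0].
Proof.
rewrite mul_series => Hw.
have [k Hk] : exists k : 'I_(size w).+1, f (take k w) * g (drop k w) != 0.
  apply/existsP; apply: contraNT Hw; rewrite negb_exists => /forallP H.
  by apply/eqP; rewrite big1 // => k _; apply/eqP; rewrite -[_ == _]negbK.
exists (take k w), (drop k w); move: Hk; rewrite mulf_eq0 negb_or cat_take_drop.
by case/andP.
Qed.

(** Both products in a bracket concatenate a word of each factor, in either order, so length and
    index sets are constant on the support. *)
Lemma liemon_support R C l m w : liemon R C l m -> m w != 0 ->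
  [/\ size w = l, wrows w = R & wcols w = C].
Proof.
move=> Hm; elim: Hm w => {R C l m} [i j|R C l m R' C' l' m' _ IH _ IH'] w.
  rewrite /xgen /sgen; case: (w =P [:: (i, j)]) => [->|_]; last by rewrite eqxx.
  by move=> _; split=> //; apply/setP => k; rewrite !inE.
rewrite sbrE add_series opp_series => Hw.
have [/smul_neq0|/smul_neq0] : (m * m') w != 0 \/ (m' * m) w != 0.
- have [H|] := eqVneq ((m * m') w) 0; last by left.
  by right; move: Hw; rewrite H sub0r oppr_eq0.
- case=> u [v [-> /IH[<- <- <-] /IH'[<- <- <-]]].
  by rewrite size_cat wrows_cat wcols_cat.
case=> u [v [-> /IH'[<- <- <-] /IH[<- <- <-]]].
by rewrite size_cat wrows_cat wcols_cat addnC (setUC (wrows u)) (setUC (wcols u)).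
Qed.

Inductive mspan : series -> Prop :=
| mspan_mon R C l m : liemon R C l m -> mspan m
| mspan_zero : mspan 0
| mspan_add f g : mspan f -> mspan g -> mspan (f + g)
| mspan_scale c f : mspan f -> mspan (c *: f).

Lemma sbrDl f f' g : sbr (f + f') g = sbr f g + sbr f' g.
Proof. by rewrite !sbrE mulrDl mulrDr opprD addrACA. Qed.

Lemma sbrN f g : sbr f g = - sbr g f.
Proof. by rewrite !sbrE opprB. Qed.

Lemma sbrZl c f g : sbr (c *: f) g = c *: sbr f g.
Proof. by rewrite !sbrE -scalerAl -scalerAr -scalerBr. Qed.

Lemma sbr0l g : sbr 0 g = 0.
Proof. by rewrite sbrE mul0r mulr0 subrr. Qed.

Lemma mspan_sbr f g : mspan f -> mspan g -> mspan (sbr f g).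
Proof.
elim=> {f} [R C l m Hm|Hg|f f' _ IHf _ IHf' Hg|c f _ IHf Hg].
- elim=> {g} [R' C' l' m' Hm'||g g' _ IHg _ IHg'|c g _ IHg].
  + exact: mspan_mon (liemon_br Hm Hm').
  + by rewrite sbrN sbr0l oppr0; apply: mspan_zero.
  + by rewrite sbrN sbrDl opprD -!(sbrN m); apply: mspan_add.
  + by rewrite sbrN sbrZl -scalerN -sbrN; apply: mspan_scale.
- by rewrite sbr0l; apply: mspan_zero.
- by rewrite sbrDl; apply: mspan_add; auto.
- by rewrite sbrZl; apply: mspan_scale; auto.
Qed.

Lemma liepoly_mspan f : liepoly f -> mspan f.
Proof.
elim=> {f} [[i j]||f g _ Hf _ Hg|c f _ Hf|f g _ Hf _ Hg].
- exact: mspan_mon (liemon_gen i j).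
- exact: mspan_zero.
- exact: mspan_add.
- exact: mspan_scale.
- exact: mspan_sbr.
Qed.

Lemma sbr_jacobi f g h : sbr f (sbr g h) = sbr (sbr f g) h + sbr g (sbr f h).
Proof.
apply: funext => w; rewrite !sbrE !mulrBl !mulrBr !mulrA.
rewrite !add_series !opp_series !add_series !opp_series; ring.
Qed.

Local Notation Fideal := (@Fideal K n p).

Lemma FidealN f : Fideal f -> Fideal (- f).
Proof. by rewrite -scaleN1r; apply: li_scale. Qed.

Lemma Fideal_sbrl f g : Fideal f -> liepoly g -> Fideal (sbr f g).
Proof. by move=> Hf Hg; rewrite sbrN; apply: FidealN; apply: li_br. Qed.

(** By Jacobi, bracketing with a generator is a derivation; on each generator of [m] it gives a
    defining relation, as both indices differ. *)
Lemma Fideal_gen_mon i j R C l m :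
  liemon R C l m -> i \notin R -> j \notin C -> Fideal (sbr (xgen K i j) m).
Proof.
elim=> {R C l m} [i' j'|R C l m R' C' l' m' Hm IH Hm' IH'].
  rewrite !inE => Hi Hj; apply: li_rel; first by exists i, i', j, j'.
  by apply: lp_br; apply: lp_gen.
rewrite !inE !negb_or => /andP[Hi Hi'] /andP[Hj Hj']; rewrite sbr_jacobi.
apply: li_add; last by apply: li_br (liemon_liepoly Hm) (IH' Hi' Hj').
exact: Fideal_sbrl (IH Hi Hj) (liemon_liepoly Hm').
Qed.

(** Induction on the first monomial, using ad [a, b] = [ad a, ad b]; the base case is
    [Fideal_gen_mon]. *)
Lemma Fideal_disjoint R C l m R' C' l' m' :
  liemon R C l m -> liemon R' C' l' m' ->
  [disjoint R & R'] -> [disjoint C & C'] -> Fideal (sbr m m').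
Proof.
move=> Hm Hm'; elim: Hm => {R C l m} [i j|R C l a S D k b Ha IHa Hb IHb].
  by rewrite !disjoints1; apply: Fideal_gen_mon Hm'.
rewrite -!setI_eq0 !setIUl !setU_eq0 !setI_eq0.
move=> /andP[HR HS] /andP[HC HD].
have -> : sbr (sbr a b) m' = sbr a (sbr b m') - sbr b (sbr a m').
  by rewrite (sbr_jacobi a) addrK.
apply: li_add; first by apply: li_br (liemon_liepoly Ha) (IHb HS HD).
by apply: FidealN; apply: li_br (liemon_liepoly Hb) (IHa HR HC).
Qed.

(* The bipartite graph supporting a bracket that survives in the quotient is
   connected; each bracketing must merge at least one row or column. *)
Lemma liemon_connected R C l m :
  liemon R C l m -> Fideal m \/ (#|R| + #|C| <= l.+1)%N.
Proof.
elim=> {R C l m} [i j|R C l m R' C' l' m' Hm IH Hm' IH'].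
  by right; rewrite !cards1.
case: IH => [IH|IH]; first by left; apply: Fideal_sbrl IH (liemon_liepoly Hm').
case: IH' => [IH'|IH']; first by left; apply: li_br (liemon_liepoly Hm) IH'.
have [HR|HR] := boolP [disjoint R & R']; last first.
  right; move: HR; rewrite -setI_eq0 -card_gt0.
  by have := cardsUI R R'; have := cardsUI C C'; lia.
have [HC|HC] := boolP [disjoint C & C'].
  by left; apply: Fideal_disjoint Hm Hm' HR HC.
right; move: HC; rewrite -setI_eq0 -card_gt0.
by have := cardsUI R R'; have := cardsUI C C'; lia.
Qed.

Definition wfull w := (wrows w == setT) && (wcols w == setT).

(** The filter keeps or kills each Lie monomial as a whole. A kept one has degree [d] and all rows
    and columns; outside the ideal, [liemon_connected] would force n + p <= d + 1. *)
Lemma Fideal_full f d :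
  liepoly f -> (d < n + p - 1)%N ->
  Fideal (sfilter (fun w => (size w == d) && wfull w) f).
Proof.
move=> /liepoly_mspan Hf Hd.
elim: Hf => {f} [R C l m Hm||f g _ Hf _ Hg|c f _ Hf].
- have [/and3P[/eqP Hl /eqP HR /eqP HC]|HQ] :=
    boolP [&& l == d, R == setT & C == setT].
    have -> : sfilter (fun w => (size w == d) && wfull w) m = m.
      apply: funext => w; rewrite /sfilter /wfull.
      have [->|/(liemon_support Hm)[-> -> ->]] := eqVneq (m w) 0.
        by case: ifP.
      by rewrite Hl HR HC !eqxx.
    case: (liemon_connected Hm) => //.
    by rewrite HR HC !cardsT !card_ord Hl; lia.
  have -> : sfilter (fun w => (size w == d) && wfull w) m = 0.
    apply: funext => w; rewrite /sfilter /wfull.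
    have [->|/(liemon_support Hm)[-> -> ->]] := eqVneq (m w) 0.
      by case: ifP.
    by rewrite (negPf HQ).
  exact: li_zero.
- by rewrite sfilter0; apply: li_zero.
- by rewrite sfilterD; apply: li_add.
- by rewrite sfilterZ; apply: li_scale.
Qed.

Lemma all_setX (I : {set 'I_n}) (J : {set 'I_p}) w :
  all (fun x => (x.1 \in I) && (x.2 \in J)) w =
  (wrows w \subset I) && (wcols w \subset J).
Proof.
elim: w => [|[i j] w IHw] /=.
  by apply/esym/andP; split; apply/subsetP => k; rewrite inE.
have -> : wrows ((i, j) :: w) = i |: wrows w.
  by apply/setP => k; rewrite !inE.
have -> : wcols ((i, j) :: w) = j |: wcols w.
  by apply/setP => k; rewrite !inE.
by rewrite IHw !subUset !sub1set andbACA.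
Qed.

Lemma sum_supset_sign (T : finType) (S : {set T}) :
  \sum_(I : {set T}) (if S \subset I then (-1) ^+ (#|T| - #|I|) else 0) =
  (S == setT)%:R :> K.
Proof.
(* Expand the product over [T] of factors 1 + 0 on [S] and 1 - 1 off [S]: it is 1 or 0 according to
   whether [S] is everything, and only the supersets of [S] contribute to the expansion. *)
have := @bigA_distr K 0 1 *%R +%R T (fun=> 1) (fun i => if i \in S then 0 else -1).
rewrite /= => H; apply: etrans (etrans (esym H) _).
  apply: eq_bigr => I _; have [HSI|] := boolP (S \subset I); last first.
    by case/subsetPn => i Hi HiI; rewrite (bigD1 i) //= (negPf HiI) Hi mul0r.
  rewrite (bigID [in I]) /= big1 => [|i HiI]; last by rewrite HiI.
  rewrite mul1r.
  rewrite (eq_bigr (fun=> -1)) => [|i HiI]; last first.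
    by rewrite !ifN //; apply: contraNN HiI; apply: (subsetP HSI).
  rewrite prodr_const -(cardC [in I]) addKn.
  by congr (_ ^+ _); apply: eq_card => i.
have [->|HS] := eqVneq S setT; first by rewrite big1 // => i _; rewrite inE addr0.
have [i _ Hi] : exists2 i, i \in setT & i \notin S.
  by apply/subsetPn; apply: contraNN HS; rewrite subTset.
by rewrite (bigD1 i) //= (negPf Hi) subrr mul0r.
Qed.

Definition full_bch : series :=
  sbch [seq sbch [seq xgen K i j | j <- enum 'I_p] | i <- enum 'I_n].

Lemma sub_bch (I : {set 'I_n}) (J : {set 'I_p}) :
  sbch [seq sbch [seq xgen K i j | j <- [seq j <- enum 'I_p | j \in J]]
       | i <- [seq i <- enum 'I_n | i \in I]] =
  sfilter (all (fun x => (x.1 \in I) && (x.2 \in J))) full_bch.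
Proof.
rewrite sfilter_sbch -sbch_filter; congr sbch; apply: eq_map => i.
rewrite sfilter_sbch.
have -> : [seq sfilter (all (fun x => (x.1 \in I) && (x.2 \in J))) (xgen K i j)
          | j <- enum 'I_p] =
    [seq if (i \in I) && (j \in J) then xgen K i j else 0 | j <- enum 'I_p].
  apply: eq_map => j; apply: funext => w; rewrite /sfilter /xgen /sgen.
  case: (eqVneq w [:: (i, j)]) => [->|Hw] /=.
    by rewrite andbT; case: ifP; rewrite ?eqxx.
  by case: ifP; case: ifP; rewrite ?(negPf Hw).
(* For a row outside [I] the inner product is empty, hence 0, which the outer product ignores. *)
rewrite sbch_filter; case: ifP => //= _.
by rewrite filter_pred0 sbch_nil.
Qed.

Lemma delta_full : @delta K n p = sfilter wfull full_bch.
Proof.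
apply: funext => w; rewrite /delta.
pose sgn (T : finType) (S I : {set T}) : K :=
  if S \subset I then (-1) ^+ (#|T| - #|I|) else 0.
(* A word survives in the [(I, J)] term exactly when [I] contains its rows and [J] its columns, so
   the signed sum factors into two sums over supersets. *)
transitivity (\sum_I \sum_J sgn _ (wrows w) I * sgn _ (wcols w) J * full_bch w).
  apply: eq_bigr => I _; apply: eq_bigr => J _.
  rewrite sub_bch /sfilter all_setX /sgn !card_ord.
  case: ifP => [/andP[-> ->]|]; last first.
    by case: subset; case: subset; rewrite //= ?mulr0 ?mul0r.
  rewrite -exprD; congr (_ ^+ _ * _).
  have HI : (#|I| <= n)%N by rewrite -[leqRHS]card_ord max_card.
  have HJ : (#|J| <= p)%N by rewrite -[leqRHS]card_ord max_card.
  by rewrite addnBA // addnBAC.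
under eq_bigr do rewrite -mulr_suml -mulr_sumr.
rewrite -!mulr_suml !sum_supset_sign /sfilter /wfull.
by case: eqP => _; case: eqP => _; rewrite /= ?mul1r ?mul0r ?mulr0 ?mul0r.
Qed.

End Monomials.


Theorem theorem1p2 (K : fieldType) (Hchar : [pchar K] =i pred0)
  (n p : nat) (Hn : (1 <= n)%N) (Hp : (1 <= p)%N) :
  forall d : nat, (d < n + p - 1)%N ->
    @Fideal K n p (@hom_component K n p d (@delta K n p)).
Proof.
move=> d Hd; have Hlie : lie_series (@full_bch K n p).
  apply: lie_series_sbch => // i; apply: lie_series_sbch => // j.
  exact: lie_series_sgen.
(* The degree is imposed twice: [shom d] yields a Lie polynomial, and the filter discards monomials
   of other lengths that may occur when it is expanded. *)
have -> : hom_component d (@delta K n p) =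
    sfilter (fun w => (size w == d) && wfull w) (shom d (@full_bch K n p)).
  rewrite delta_full; apply: funext => w.
  by rewrite /hom_component /sfilter /shom; case: ifP.
exact: Fideal_full (((lie_seriesP _).1 Hlie).2 d) Hd.
Qed.
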